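(* Let $q$ be a prime power, $m\ge 1$, $n\ge 2$, and let $C$ be an $[n,1]$ cyclic code over $\mathbb{F}_{q^m}$ with generator polynomial $g(x)$. Then the rank weight of $C$ (relative to $\mathbb{F}_q$) is $[\mathbb{F}_q(g(0)):\mathbb{F}_q]$.
   Context: An $[n,k]$ linear code over $\mathbb{F}_{q^m}$ is a $k$-dimensional $\mathbb{F}_{q^m}$-subspace $C$ of $\mathbb{F}_{q^m}^n$. It is cyclic with generator polynomial $g(x)$ (monic, dividing $x^n-1$, of degree $n-k$) if, identifying vectors with polynomials of degree $\le n-1$, $C$ is the ideal generated by $g(x)$ in $\mathbb{F}_{q^m}[x]/(x^n-1)$, i.e. $C=\{c(x)g(x) : c(x)\in\mathbb{F}_{q^m}[x],\ \deg c\le k-1\}$. The rank weight of a vector $c=(c_1,\dots,c_n)\in\mathbb{F}_{q^m}^n$ is the rank over $\mathbb{F}_q$ of the $m\times n$ matrix $\lambda(c)$ whose $i$-th column is the coordinate vector of $c_i$ in a fixed $\mathbb{F}_q$-basis of $\mathbb{F}_{q^m}$ (equivalently, the $\mathbb{F}_q$-dimension of the span of $c_1,\dots,c_n$). The rank weight (rank distance) of a code $C$ is $d_1(\lambda(C))=\min_{c\in C,\,c\ne 0}\mathrm{rk}(\lambda(c))$. *)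

(* Defs.v *)
From HB Require Import structures.
From mathcomp Require Import all_boot all_order all_algebra all_field.

Set Implicit Arguments.
Unset Strict Implicit.
Unset Printing Implicit Defensive.

Import GRing.Theory.
Local Open Scope ring_scope.

Definition linear_code (L : fieldType) (n k : nat) (C : {vspace 'rV[L]_n}) :
  Prop := \dim C = k.

(* A vector (c_0, ..., c_(n-1)) is identified with \sum_i c_i X^i by rVpoly,
   and L[X]/(X^n - 1) is represented by remainders modulo X^n - 1: the last
   condition says that C is the ideal generated by g in that quotient. *)
Definition cyclic_code (L : fieldType) (n k : nat) (C : {vspace 'rV[L]_n})
    (g : {poly L}) : Prop :=
  [/\ linear_code k C,
      g \is monic,
      g %| 'X^n - 1,
      size g = (n - k).+1
    & forall v : 'rV[L]_n,
        v \in C <-> exists c : {poly L}, rVpoly v = (c * g) %% ('X^n - 1)].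

Section RankWeight.

Variables (F : fieldType) (L : fieldExtType F) (m n : nat).

Definition coord_mx (b : m.-tuple L) (c : 'rV[L]_n) : 'M[F]_(m, n) :=
  \matrix_(i < m, j < n) coord b i (c 0 j).

Definition rank_weight (b : m.-tuple L) (c : 'rV[L]_n) : nat :=
  \rank (coord_mx b c).

(* d is the minimum of the rank weights of the nonzero codewords of C; no d
   satisfies this when C is the zero code. *)
Definition is_code_rank_weight (b : m.-tuple L) (C : {vspace 'rV[L]_n})
    (d : nat) : Prop :=
  (exists c : 'rV[L]_n, [/\ c \in C, c != 0 & rank_weight b c = d]) /\
  (forall c : 'rV[L]_n, c \in C -> c != 0 -> (d <= rank_weight b c)%N).

End RankWeight.

(* Main.v *)
Require Import Defs.
From HB Require Import structures.
From mathcomp Require Import all_boot all_order all_algebra all_field.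

Set Implicit Arguments.
Unset Strict Implicit.
Unset Printing Implicit Defensive.

Import GRing.Theory VectorInternalTheory.
Local Open Scope ring_scope.

(** Write [X^n - 1 = (X - a) g] and [u = g(0)]. Comparing coefficients gives
    [a u = 1] and [g_j = u^(j+1)], with [u^n = 1] since [g] is monic. A nonzero
    codeword is a scalar multiple of [(u, u^2, ..., u^n)], and these powers span
    [F(u)] over [F], so every nonzero codeword has rank weight [[F(u) : F]]. *)

(** Both dimensions are matrix ranks. Writing each entry of [X] in the basis [b] factors the
    internal matrix of [X] as the transposed coordinate matrix times that of [b], and right
    multiplication by a row-free matrix preserves rank. *)
Lemma dim_span_coord (K : fieldType) (vT : vectType K) (m n : nat)
    (b : m.-tuple vT) (X : n.-tuple vT) :
  basis_of {:vT} b ->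
  \dim <<X>> = \rank (\matrix_(i < m, j < n) coord b i X`_j).
Proof.
move=> hb.
have dim_b2mx k (Y : k.-tuple vT) :
    \dim <<Y>> = \rank (b2mx Y).
  rewrite unlock /dimv genmxE; case: Y => s sz_s /=.
  (* The span of a sequence is built on a tuple of length [size s], so [k] is replaced by that
     length. *)
  have Dk := eqP sz_s; case: k / Dk sz_s => sz_s.
  by congr (\rank (b2mx _)); apply: val_inj.
have b_free : row_free (b2mx b).
  by rewrite /row_free -dim_b2mx (eqP (basis_free hb)) size_tuple.
rewrite -[RHS]mxrank_tr -(mxrankMfree _ b_free) dim_b2mx.
congr (\rank _); apply/row_matrixP => j.
rewrite row_mul mulmx_sum_row rowK (tnth_nth 0).
rewrite [in LHS](coord_basis hb (memvf X`_j)) linear_sum.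
apply: eq_bigr => i _.
by rewrite linearZ /= rowK !mxE (tnth_nth 0).
Qed.

Lemma rank_weight_span (F : fieldType) (L : fieldExtType F) (m n : nat)
    (b : m.-tuple L) (c : 'rV[L]_n) :
  basis_of {:L} b -> rank_weight b c = \dim <<[seq c 0 j | j : 'I_n]>>.
Proof.
move=> hb; rewrite (dim_span_coord [tuple c 0 j | j < n] hb).
congr (\rank _); apply/matrixP => i j.
by rewrite !mxE -tnth_nth tnth_mktuple.
Qed.

(** Since [u ^+ n = 1], the exponents 1 to [n] represent every residue mod [n], so each monomial of
    a polynomial in [u] is already in the list. *)
Lemma span_powers (F : fieldType) (L : fieldExtType F) (n : nat) (u : L) :
  (0 < n)%N -> u ^+ n = 1 ->
  <<[seq (u ^+ j.+1)%R | j : 'I_n]>>%VS = <<1; u>>%VS.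
Proof.
move=> n_gt0 un1; apply/eqP; rewrite eqEsubv; apply/andP; split.
  apply/span_subvP => _ /imageP[j _ ->].
  by rewrite rpredX // memv_adjoin.
apply/subvP => _ /Fadjoin_polyP[p /polyOver1P[r ->] ->].
rewrite horner_coef; apply: memv_suml => i _.
rewrite coef_map /= mulr_algl memvZ //; apply: memv_span.
(* The index for [u ^+ i] is [i - 1] mod [n]; adding [n.-1] avoids truncated subtraction at
   [i = 0]. *)
have lt_j : ((i + n.-1) %% n < n)%N by rewrite ltn_pmod.
apply/imageP; exists (Ordinal lt_j) => //=.
by rewrite exprS expr_mod // -exprS -addnS prednK // exprD un1 mulr1 //.
Qed.

Lemma size2_monicE (R : nzRingType) (p : {poly R}) :
  p \is monic -> size p = 2%N -> p = 'X + (p`_0)%:P.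
Proof.
move=> /monicP mp sp; apply/polyP => -[|[|i]]; rewrite !coefE /= ?add0r //.
  by rewrite -mp /lead_coef sp addr0.
by rewrite nth_default // sp.
Qed.

Section OneDimensionalCyclicCode.

Variables (L : fieldType) (n : nat) (g : {poly L}).
Hypotheses (n_gt0 : (0 < n)%N) (g_monic : g \is monic).
Hypotheses (g_dvd : g %| 'X^n - 1) (g_size : size g = n).

Lemma cofactor_linear : exists a, 'X^n - 1 = ('X - a%:P) * g.
Proof.
have [h Dh] := dvdpP _ _ g_dvd.
have Xn_monic : ('X^n - 1 : {poly L}) \is monic by rewrite monicXnsubC.
have h_monic : h \is monic by rewrite -(monicMr _ g_monic) -Dh.
have h_size : size h = 2%N.
  have := size_Mmonic (monic_neq0 h_monic) g_monic.
  rewrite -Dh size_XnsubC // g_size => Dn.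
  by apply: (@addIn n); rewrite add2n Dn prednK // addn_gt0 n_gt0 orbT.
by exists (- h`_0); rewrite Dh {1}(size2_monicE h_monic h_size) polyCN opprK.
Qed.

Lemma generator_coef j : (j < n)%N -> g`_j = g.[0] ^+ j.+1.
Proof.
have [a Da] := cofactor_linear.
have Dcoef k := congr1 (fun p : {poly L} => p`_k) Da.
have au1 : a * g.[0] = 1.
  have := Dcoef 0; rewrite horner_coef0 mulrBl !coefE /=.
  by rewrite eq_sym (gtn_eqF n_gt0) !sub0r => /oppr_inj.
elim: j => [|j IHj] ltjn; first by rewrite horner_coef0.
(* As [0 < j.+1 < n], this coefficient of ['X^n - 1] vanishes, which leaves [g_j = a g_(j+1)];
   multiplying by [g.[0]], the inverse of [a], moves up one index. *)
have := Dcoef j.+1; rewrite mulrBl !coefE /= (ltn_eqF ltjn) subr0.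
move/esym/subr0_eq => gj.
by rewrite exprS -IHj ?(ltnW ltjn) // gj mulrA (mulrC _ a) au1 mul1r.
Qed.

Lemma generator0_unity : g.[0] ^+ n = 1.
Proof.
rewrite -(prednK n_gt0) -generator_coef ?prednK //.
by have /monicP := g_monic; rewrite /lead_coef g_size.
Qed.

(** Modulo ['X - a] the polynomial [c] is the constant [c.[a]], and multiplication by [g] turns this
    into a congruence modulo ['X^n - 1]. The scalar is thus [c.[a]]. *)
Lemma codeword_coef (v : 'rV[L]_n) (c : {poly L}) :
    rVpoly v = (c * g) %% ('X^n - 1) ->
  exists l : L, forall j : 'I_n, v 0 j = l * g.[0] ^+ j.+1.
Proof.
have [a Da] := cofactor_linear.
have modE : (c * g) %% ('X^n - 1) = c.[a]%:P * g.
  have /dvdpP[q Dq] : 'X - a%:P %| c - c.[a]%:P.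
    by rewrite -root_factor_theorem rootE !hornerE subrr.
  have -> : c = q * ('X - a%:P) + c.[a]%:P by rewrite -Dq subrK.
  rewrite mulrDl -mulrA -Da modpD modp_mull add0r !hornerE subrr mulr0 add0r.
  rewrite modp_small // size_XnsubC // mul_polyC.
  by rewrite (leq_ltn_trans (size_scale_leq _ _)) // g_size.
rewrite modE => Dv; exists c.[a] => j.
by rewrite -coef_rVpoly_ord Dv coefCM generator_coef.
Qed.

End OneDimensionalCyclicCode.

Theorem lemma2 (F : finFieldType) (L : fieldExtType F) (q m n : nat)
    (hq : #|F| = q) (hm : \dim {:L} = m) (m_gt0 : (1 <= m)%N)
    (b : m.-tuple L) (hb : basis_of {:L} b) (n_ge2 : (2 <= n)%N)
    (C : {vspace 'rV[L]_n}) (g : {poly L}) (hC : cyclic_code 1 C g) :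
  is_code_rank_weight b C (\dim <<1; g.[0]>>%VS).
Proof.
have n_gt0 : (0 < n)%N := ltnW n_ge2.
case: hC => _ g_monic g_dvd; rewrite subn1 prednK // => g_size memC.
have wt c : c \in C -> c != 0 -> rank_weight b c = \dim <<1; g.[0]>>%VS.
  move=> /memC[p Dp] c_neq0.
  have [l Dc] := codeword_coef n_gt0 g_monic g_dvd g_size Dp.
  have l_neq0 : l != 0.
    apply: contraNneq c_neq0 => l0; apply/eqP/rowP => j.
    by rewrite Dc l0 mul0r mxE.
  have un1 := generator0_unity n_gt0 g_monic g_dvd g_size.
  rewrite (rank_weight_span c hb) -(span_powers n_gt0 un1).
  (* Multiplication by the nonzero [l] is an injective [F]-linear map of [L], so it preserves the
     dimension of the span. *)
  rewrite -[RHS](dim_cosetv _ l_neq0) -limg_amulr limg_span.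
  congr (\dim <<_>>); rewrite -map_comp; apply: eq_map => j /=.
  by rewrite lfunE /= Dc mulrC.
(* The minimum is attained at [g] itself, whose size [n] lets it fit in a row without truncation. *)
have rVg : rVpoly (poly_rV g : 'rV_n) = g by rewrite poly_rV_K ?g_size.
have g_in : poly_rV g \in C.
  apply/memC; exists 1.
  by rewrite rVg mul1r modp_small // size_XnsubC // g_size.
have g_neq0 : (poly_rV g : 'rV_n) != 0.
  by apply: contraNneq (monic_neq0 g_monic) => g0; rewrite -rVg g0 linear0.
split; last by move=> c cC c_neq0; rewrite wt.
by exists (poly_rV g); rewrite wt.
Qed.
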